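(* Let $M$ be a manifold, $E$ an oriented vector bundle over $M$ of rank $4n$, $h$ a neutral metric of $E$, and $\nabla$ an $h$-connection of $E$ (a connection with $\nabla h=0$). Let $N$ be an $H$-nilpotent structure of $(E,h)$, let $N^\times$ be its dual $H$-nilpotent structure, and set $$I:=\frac12(N+N^\times),\quad J_2:=\frac12(N-N^\times),\quad J_1:=-IJ_2.$$ Then $I$ is a complex structure of $E$, $J_1,J_2$ are paracomplex structures of $E$, and $I,J_1,J_2$ give a paraquaternionic structure $E_{I,J_1,J_2}$ such that $h$ is adapted to $E_{I,J_1,J_2}$. In addition, if $N$ is an $H$-nilpotent structure of $(E,h,\nabla)$, then $h,\nabla,I,J_1,J_2$ form a neutral hyperK\''{a}hler structure of $E$.
   Context: Everything is smooth. $h$ neutral means that $h$ is a bundle metric of signature $(2n,2n)$. An ordered pseudo-orthonormal local frame field $e=(e_1,\dots,e_{4n})$ of $(E,h)$ always has $e_1,\dots,e_{2n}$ space-like ($h(e_i,e_i)=1$) and $e_{2n+1},\dots,e_{4n}$ time-like ($h(e_i,e_i)=-1$). For $\varepsilon\in\{+,-\}$ set $I_{1,\pm}:=\pm1$ and $I_{n,\pm}:={\rm diag}(\pm1,1,\dots,1)$ ($n\times n$) for $n\ge2$; $I'_{4n,\varepsilon}:={\rm diag}(I_n,I_n,I_n,I_{n,\varepsilon})$ (block diagonal), and $$\Lambda_n:=\left[\begin{array}{cccc}O_n&-I_n&O_n&I_n\\ I_n&O_n&I_n&O_n\\ O_n&I_n&O_n&-I_n\\ I_n&O_n&I_n&O_n\end{array}\right],$$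 with $I_n$, $O_n$ the $n\times n$ unit and zero matrices. A section $N$ of ${\rm End}\,E$ is an $\varepsilon$-nilpotent structure of $(E,h)$ if on a neighborhood of each point of $M$ there is an ordered pseudo-orthonormal local frame field $e$ of $(E,h)$ giving the orientation of $E$ with $NeI'_{4n,\varepsilon}=eI'_{4n,\varepsilon}\Lambda_n$ (frames are treated as row vectors); such an $e$ is called an admissible frame field of $N$. $H$ is the Lie subgroup of $SO(2n,2n)$ consisting of all elements of $SO(2n,2n)$ of the form (with $n\times n$ blocks) $$\left[\begin{array}{cccc}A_{11}&-A_{21}&A_{31}&A_{41}\\ A_{21}&A_{11}&-A_{41}&A_{31}\\ A_{31}&-A_{41}&A_{11}&A_{21}\\ A_{41}&A_{31}&-A_{21}&A_{11}\end{array}\right].$$ An $\varepsilon$-nilpotent structure $N$ of $(E,h)$ ($\varepsilon=+$ or $-$) is called an $H$-nilpotent structure of $(E,h)$ if there exist an open cover $\{U_\lambda\}_{\lambda\in\Lambda}$ of $M$ and a family $\{e_\lambda\}_{\lambda\in\Lambda}$ of admissible frame fields of $N$ such that (i) each $e_\lambda$ is defined on $U_\lambda$; (ii) if $U_\lambda\cap U_\mu\ne\emptyset$, then $e_\mu I'_{4n,\varepsilon}=e_\lambda I'_{4n,\varepsilon}A_{\lambda\mu}$ on $U_\lambda\cap U_\mu$ for a function $A_{\lambda\mu}$ valued in $H$. Such a family determines a principal $H$-bundle $P$ over $M$ associated with $E$, of which each $e_\lambda I'_{4n,\varepsilon}$ is a local section. An $H$-nilpotent structure $N$ is considered together with this bundle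 $P$. An admissible frame field $e$ of $N$ is $H$-admissible if $eI'_{4n,\varepsilon}$ is a local section of $P$, i.e., if it differs from each $e_\lambda I'_{4n,\varepsilon}$ on the overlap by right multiplication by an $H$-valued function. $N$ (with its bundle $P$) is an $H$-nilpotent structure of $(E,h,\nabla)$ if in addition (iii) the connection form $\omega_\lambda$ of $\nabla$ with respect to $e_\lambda I'_{4n,\varepsilon}$, defined by $\nabla(e_\lambda I'_{4n,\varepsilon})=e_\lambda I'_{4n,\varepsilon}\omega_\lambda$, is valued in the Lie algebra of $H$ for each $\lambda$. The dual $H$-nilpotent structure $N^\times$ of $N$ is the unique $\varepsilon$-nilpotent and $H$-nilpotent structure of $(E,h)$ such that each $H$-admissible frame field of $N^\times$ is given by $e'=(e_1,\dots,e_{2n},-e_{2n+1},\dots,-e_{4n})$ for an $H$-admissible frame field $e$ of $N$; thus $N^\times e'I'_{4n,\varepsilon}=e'I'_{4n,\varepsilon}\Lambda_n$ for each $H$-admissible frame field $e$ of $N$. A complex structure $I$ of $E$ is a section of ${\rm End}\,E$ with $I^2=-{\rm id}$; a paracomplex structure $J$ of $E$ is a section of ${\rm End}\,E$ with $J^2={\rm id}$ whose $\pm1$-eigenbundles have equal rank. $I,J_1,J_2$ give a paraquaternionic structure $E_{I,J_1,J_2}$ if (i) $IJ_1=J_2$ and $I,J_1,J_2$ span a subbundle $E_{I,J_1,J_2}$ of ${\rm End}\,E$ of rank $3$. $h$ is adapted to $E_{I,J_1,J_2}$ if (ii) $I$ preserves $h$ ($h(I\cdot,I\cdot)=h$) and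 $J_1,J_2$ reverse $h$ ($h(J_k\cdot,J_k\cdot)=-h$). $h,\nabla,I,J_1,J_2$ form a neutral hyperK\''{a}hler structure of $E$ if (i), (ii) hold and (iii) $\nabla I=0$, $\nabla J_1=0$, $\nabla J_2=0$. *)

(* Defs.v *)
From HB Require Import structures.
From mathcomp Require Import all_boot all_order all_algebra.
From mathcomp Require Import all_classical all_reals all_analysis.
Import Order.TTheory GRing.Theory Num.Theory numFieldNormedType.Exports.

Set Implicit Arguments.
Unset Strict Implicit.
Unset Printing Implicit Defensive.

Local Open Scope classical_set_scope.
Local Open Scope ring_scope.

(* Conventions.  Functions, sections and frames "on U" are total functions on
   the whole base whose values outside U are irrelevant: every predicate
   below that takes a set U only looks at points of U.  U is open whenever
   such a predicate is used. *)

Section SmoothFunctions.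
Variables (R : realType) (m : nat).
Implicit Types (O : set 'rV[R]_m) (f : 'rV[R]_m -> R).

Fixpoint Ck (k : nat) O f : Prop :=
  (forall x, O x -> {for x, continuous f}) /\
  if k is k'.+1 then
    forall i : 'I_m,
      (forall x, O x -> derivable f x (delta_mx 0 i)) /\
      Ck k' O ('D_(delta_mx 0 i) f)
  else True.

Definition Cinfty O f : Prop := forall k, Ck k O f.

End SmoothFunctions.

(* The atlas need not be maximal; [ch_map i] and [ch_inv i] are only meaningful
   on [ch_dom i] and on its image. *)
Record manifold (R : realType) (m : nat) := Manifold {
  carrier :> topologicalType;
  mf_hausdorff : hausdorff_space carrier;
  mf_second_countable : @second_countable carrier;
  ch_idx : Type;
  ch_dom : ch_idx -> set carrier;
  ch_map : ch_idx -> carrier -> 'rV[R]_m;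
  ch_inv : ch_idx -> 'rV[R]_m -> carrier;
  ch_cover : forall x, exists i, ch_dom i x;
  ch_open : forall i, open (ch_dom i);
  ch_open_image : forall i, open (ch_map i @` ch_dom i);
  ch_mapK : forall i x, ch_dom i x -> ch_inv i (ch_map i x) = x;
  ch_continuous : forall i x, ch_dom i x -> {for x, continuous (ch_map i)};
  ch_inv_continuous : forall i y,
    (ch_map i @` ch_dom i) y -> {for y, continuous (ch_inv i)};
  ch_transition : forall i j (a : 'I_m),
    Cinfty (ch_map i @` (ch_dom i `&` ch_dom j))
           (fun y => ch_map j (ch_inv i y) 0 a)
}.

Section Manifold.
Variables (R : realType) (m : nat) (M : manifold R m).
Implicit Types (U W : set M) (x : M) (f g : M -> R).

Definition smooth_on U f : Prop := forall i,
  Cinfty (ch_map i @` (ch_dom i `&` U)) (fun y => f (ch_inv i y)).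

Definition smooth_near x f : Prop :=
  exists U, [/\ open U, U x & smooth_on U f].

(* Tangent vectors at x are derivations of the algebra of germs at x of smooth
   functions.  Sending functions that are not smooth near x to 0 makes the
   representing functional unique. *)
Definition is_tangent x (v : (M -> R) -> R) : Prop :=
  [/\ forall f g, (\forall y \near x, f y = g y) -> v f = v g,
      forall (a : R) f g, smooth_near x f -> smooth_near x g ->
        v (fun y => a * f y + g y) = a * v f + v g,
      forall f g, smooth_near x f -> smooth_near x g ->
        v (fun y => f y * g y) = v f * g x + f x * v g
    & forall f, ~ smooth_near x f -> v f = 0].

Definition smooth_vector_field U (X : M -> (M -> R) -> R) : Prop :=
  (forall x, U x -> is_tangent x (X x)) /\
  (forall W f, open W -> W `<=` U -> smooth_on W f ->
     smooth_on W (fun x => X x f)).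

End Manifold.

Section Frames.
Variables (R : realType) (V : vectType R) (k : nat).

Definition is_basis (e : 'I_k -> V) : Prop :=
  basis_of fullv [tuple e i | i < k].

(* A frame is a row vector (e_1, ..., e_k); [fmul e A] is the product e A. *)
Definition fmul (e : 'I_k -> V) (A : 'M[R]_k) : 'I_k -> V :=
  fun j => \sum_(i < k) A i j *: e i.

End Frames.

(* A real vector bundle of rank k: a family of vector spaces together with a
   cover by local frames (equivalently, local trivializations) which differ on
   overlaps by smooth matrices. *)
Record vbundle (R : realType) (m : nat) (M : manifold R m) (k : nat) :=
  VBundle {
  fiber :> M -> vectType R;
  vb_idx : Type;
  vb_dom : vb_idx -> set M;
  vb_frame : forall (i : vb_idx) (x : M), 'I_k -> fiber x;
  vb_cover : forall x, exists i, vb_dom i x;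
  vb_open : forall i, open (vb_dom i);
  vb_basis : forall i x, vb_dom i x -> is_basis (vb_frame i x);
  vb_transition : forall i j, exists g : M -> 'M[R]_k,
    (forall a b, smooth_on (vb_dom i `&` vb_dom j) (fun x => g x a b)) /\
    (forall x, (vb_dom i `&` vb_dom j) x ->
       vb_frame j x = fmul (vb_frame i x) (g x))
}.

Section Bundle.
Variables (R : realType) (m : nat) (M : manifold R m).
Variables (k : nat) (E : vbundle M k).
Implicit Types (U : set M) (x : M).

Definition sect := forall x : M, E x.
Definition end_sect := forall x : M, 'End(E x).
Definition frame_field := forall x : M, 'I_k -> E x.

Definition smooth_sect U (s : sect) : Prop := forall i : vb_idx E,
  exists c : M -> 'I_k -> R,
    (forall a, smooth_on (U `&` vb_dom i) (fun x => c x a)) /\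
    (forall x, (U `&` vb_dom i) x ->
       s x = \sum_(a < k) c x a *: vb_frame i x a).

Definition smooth_end_sect U (A : end_sect) : Prop := forall i : vb_idx E,
  exists c : M -> 'M[R]_k,
    (forall a b, smooth_on (U `&` vb_dom i) (fun x => c x a b)) /\
    (forall x, (U `&` vb_dom i) x ->
       (fun a => A x (vb_frame i x a)) = fmul (vb_frame i x) (c x)).

Definition smooth_sect_near x (s : sect) : Prop :=
  exists U, [/\ open U, U x & smooth_sect U s].

Definition local_frame U (e : frame_field) : Prop :=
  (forall x, U x -> is_basis (e x)) /\
  (forall i, smooth_sect U (fun x => e x i)).

(* An orientation is a choice, in each fibre, of one of the two classes of
   ordered bases, given locally by smooth frames. *)
Record orientation := Orientation {
  positive : forall x, ('I_k -> E x) -> Prop;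
  positive_basis : forall x (e : 'I_k -> E x), positive e -> is_basis e;
  positive_fmul : forall x (e : 'I_k -> E x) (A : 'M[R]_k),
    positive e -> (positive (fmul e A) <-> 0 < \det A);
  positive_local : forall x, exists U e,
    [/\ open U, U x, local_frame U e & forall y, U y -> positive (e y)]
}.

(* [cov x v s] is the covariant derivative at x of s in the direction v; it is
   meaningful for v tangent at x and s smooth near x.  Locality makes it a
   connection acting on sections over arbitrary open sets. *)
Record connection := Connection {
  cov :> forall x : M, ((M -> R) -> R) -> sect -> E x;
  cov_local : forall x v (s t : sect), is_tangent x v ->
    smooth_sect_near x s -> (\forall y \near x, s y = t y) ->
    cov x v s = cov x v t;
  cov_linear : forall x (a : R) v w (s : sect), is_tangent x v ->
    is_tangent x w -> smooth_sect_near x s ->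
    cov x (fun f => a * v f + w f) s = a *: cov x v s + cov x w s;
  cov_add : forall x v (s t : sect), is_tangent x v ->
    smooth_sect_near x s -> smooth_sect_near x t ->
    cov x v (fun y => s y + t y) = cov x v s + cov x v t;
  cov_leibniz : forall x v f (s : sect), is_tangent x v ->
    smooth_near x f -> smooth_sect_near x s ->
    cov x v (fun y => f y *: s y) = v f *: s x + f x *: cov x v s;
  cov_smooth : forall U X (s : sect), open U ->
    smooth_vector_field U X -> smooth_sect U s ->
    smooth_sect U (fun x => cov x (X x) s)
}.

Implicit Types (D : connection) (A I : end_sect).

(* D A = 0 for the induced connection
   (D_v A) s = D_v (A s) - A (D_v s) of End E. *)
Definition parallel D A : Prop := forall x v (s : sect),
  is_tangent x v -> smooth_sect_near x s ->
  D x v (fun y => A y (s y)) - A x (D x v s) = 0.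

Definition end_subbundle (F : forall x, {vspace 'End(E x)}) (r : nat) : Prop :=
  forall x, exists U (B : 'I_r -> end_sect),
    [/\ open U, U x, forall i, smooth_end_sect U (B i)
      & forall y, U y -> basis_of (F y) [tuple B i y | i < r]].

Definition complex_structure I : Prop :=
  smooth_end_sect setT I /\ (forall x, (I x \o I x)%VF = - \1%VF).

Definition paracomplex_structure (J : end_sect) : Prop :=
  [/\ smooth_end_sect setT J,
      forall x, (J x \o J x)%VF = \1%VF
    & forall x, \dim (passmx.leigenspace (J x) 1) =
                \dim (passmx.leigenspace (J x) (-1))].

Definition pq_span I (J1 J2 : end_sect) : forall x, {vspace 'End(E x)} :=
  fun x => <<[:: I x; J1 x; J2 x]>>%VS.

Definition paraquaternionic I (J1 J2 : end_sect) : Prop :=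
  (forall x, (I x \o J1 x)%VF = J2 x) /\ end_subbundle (pq_span I J1 J2) 3.

End Bundle.

Section MatrixGroups.
Variables (R : realType) (n : nat).
Local Notation M4 := 'M[R]_(n + n + (n + n)).

(* The parameter [eps : bool] encodes the sign (-1)^eps: false is +, true
   is -. *)
Definition Ieps (eps : bool) : 'M[R]_n :=
  diag_mx (\row_(j < n) if j == 0%N :> nat then (-1) ^+ eps else 1).

Definition I4eps (eps : bool) : M4 :=
  block_mx 1%:M 0 0 (block_mx 1%:M 0 0 (Ieps eps)).

Definition Lam : M4 :=
  block_mx (block_mx 0 (- 1%:M) 1%:M 0) (block_mx 0 1%:M 1%:M 0)
           (block_mx 0 1%:M 1%:M 0) (block_mx 0 (- 1%:M) 1%:M 0).

Definition eta : M4 := block_mx 1%:M 0 0 (- 1%:M).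

Definition SO22 : set M4 :=
  [set A | A^T *m eta *m A = eta /\ \det A = 1].

Definition H_form : set M4 :=
  [set A | exists A11 A21 A31 A41 : 'M[R]_n,
     A = block_mx (block_mx A11 (- A21) A21 A11)
                  (block_mx A31 A41 (- A41) A31)
                  (block_mx A31 (- A41) A41 A31)
                  (block_mx A11 A21 (- A21) A11)].

Definition Hgrp : set M4 := SO22 `&` H_form.

End MatrixGroups.

(* The Lie algebra of a (closed) matrix group G, as the tangent space of G at
   the unit matrix: the velocities at 0 of smooth curves in G through 1. *)
Definition lie_algebra (R : realType) (k : nat) (G : set 'M[R]_k) :
    set 'M[R]_k :=
  [set X | exists c : R -> 'M[R]_k,
     [/\ forall i j r t, derivable (derive1n r (fun t => c t i j)) t 1,
         forall t, G (c t),
         c 0 = 1%:M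
       & forall i j, derive1 (fun t => c t i j) 0 = X i j]].

Section Nilpotent.
Variables (R : realType) (m : nat) (M : manifold R m) (n : nat).
Variable E : vbundle M (n + n + (n + n)).
Implicit Types (U : set M) (x : M) (N I : end_sect E).
Implicit Types (e : frame_field E) (D : connection E).

Definition pseudo_orthonormal x (h : E x -> E x -> R)
    (e : 'I_(n + n + (n + n)) -> E x) : Prop :=
  forall i j, h (e i) (e j) = eta R n i j.

Record neutral_metric := NeutralMetric {
  metric :> forall x, E x -> E x -> R;
  metric_sym : forall x (u v : E x), metric u v = metric v u;
  metric_linear : forall x (a : R) (u v w : E x),
    metric (a *: u + v) w = a * metric u w + metric v w;
  metric_smooth : forall (i : vb_idx E) a b,
    smooth_on (vb_dom i)
              (fun x => metric (vb_frame i x a) (vb_frame i x b));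
  metric_signature : forall x, exists e : 'I_(n + n + (n + n)) -> E x,
    is_basis e /\ pseudo_orthonormal (@metric x) e
}.

Definition metric_connection (h : neutral_metric) D : Prop :=
  forall x v (s t : sect E),
    is_tangent x v -> smooth_sect_near x s -> smooth_sect_near x t ->
    v (fun y => h y (s y) (t y)) = h x (D x v s) (t x) + h x (s x) (D x v t).

Definition adapted (h : neutral_metric) I (J1 J2 : end_sect E) : Prop :=
  [/\ forall x u v, h x (I x u) (I x v) = h x u v,
      forall x u v, h x (J1 x u) (J1 x v) = - h x u v
    & forall x u v, h x (J2 x u) (J2 x v) = - h x u v].

Definition neutral_hyperkahler (h : neutral_metric) D I
    (J1 J2 : end_sect E) : Prop :=
  [/\ complex_structure I,
      paracomplex_structure J1 /\ paracomplex_structure J2,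
      paraquaternionic I J1 J2,
      adapted h I J1 J2
    & [/\ parallel D I, parallel D J1 & parallel D J2]].

Variables (o : orientation E) (h : neutral_metric) (eps : bool).

Definition admissible N U e : Prop :=
  [/\ local_frame U e,
      forall x, U x -> pseudo_orthonormal (@h x) (e x),
      forall x, U x -> positive o (e x)
    & forall x, U x ->
        (fun j => N x (fmul (e x) (I4eps R n eps) j)) =
        fmul (fmul (e x) (I4eps R n eps)) (Lam R n)].

Definition eps_nilpotent N : Prop :=
  smooth_end_sect setT N /\
  forall x, exists U e, [/\ open U, U x & admissible N U e].

(* A family of local frame fields e_l on U_l.  It stands for the principal
   H-bundle of which the e_l I' (I' := I4eps) are local sections. *)
Record frame_family := FrameFamily {
  ff_idx : Type;
  ff_dom : ff_idx -> set M;
  ff_frame : ff_idx -> frame_field E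
}.
Implicit Type P : frame_family.

Definition H_related x (e e' : 'I_(n + n + (n + n)) -> E x) : Prop :=
  exists2 A, Hgrp A &
    fmul e' (I4eps R n eps) = fmul (fmul e (I4eps R n eps)) A.

(* The H-valued transition functions are unique and automatically smooth, so
   their existence may be required pointwise. *)
Definition H_nilpotent N P : Prop :=
  [/\ eps_nilpotent N,
      forall l : ff_idx P, open (ff_dom l),
      forall x, exists l : ff_idx P, ff_dom l x,
      forall l : ff_idx P, admissible N (ff_dom l) (ff_frame l)
    & forall (l l' : ff_idx P) x, (ff_dom l `&` ff_dom l') x ->
        H_related (ff_frame l x) (ff_frame l' x)].

Definition H_admissible N P U e : Prop :=
  admissible N U e /\
  forall (l : ff_idx P) x, (U `&` ff_dom l) x -> H_related (ff_frame l x) (e x).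

Definition connection_form D U e
    (w : M -> ((M -> R) -> R) -> 'M[R]_(n + n + (n + n))) : Prop :=
  forall x v, U x -> is_tangent x v ->
    (fun j => D x v (fun y => fmul (e y) (I4eps R n eps) j)) =
    fmul (fmul (e x) (I4eps R n eps)) (w x v).

Definition H_nilpotent_conn D N P : Prop :=
  H_nilpotent N P /\
  forall l : ff_idx P, exists2 w, connection_form D (ff_dom l) (ff_frame l) w &
    forall x v, ff_dom l x -> is_tangent x v ->
      lie_algebra (@Hgrp R n) (w x v).

Definition flip_time x (e : 'I_(n + n + (n + n)) -> E x) :
    'I_(n + n + (n + n)) -> E x :=
  fun i => if (i < n + n)%N then e i else - e i.

(* This determines Nx, and Px up to equivalence of families (that is, up to
   the choice of local sections of the same principal H-bundle). *)
Definition H_dual N P (Nx : end_sect E) (Px : frame_family) : Prop :=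
  H_nilpotent Nx Px /\
  forall U e', open U ->
    (H_admissible Nx Px U e' <->
     exists2 e, H_admissible N P U e &
       forall x, U x -> e' x = flip_time (e x)).

End Nilpotent.

(* Main.v *)
Require Import Defs.
From mathcomp Require Import all_boot all_order all_algebra.
From mathcomp Require Import all_classical all_reals all_analysis.
From mathcomp Require Import ring lra.
Import Order.TTheory GRing.Theory Num.Theory numFieldNormedType.Exports.
Set Implicit Arguments.
Unset Strict Implicit.
Unset Printing Implicit Defensive.
Local Open Scope classical_set_scope.
Local Open Scope ring_scope.

(** Let e be a local section of P and f = e I'.  Then N f = f Lam.  Since the
    flipped frame e eta, eta = diag(1, -1), is admissible for the dual structure
    and eta commutes with I', the dual structure satisfies
    Nx f = f (eta Lam eta).  Conjugation by eta changes the sign of the two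
    off-diagonal blocks, so in the frame f the endomorphism I is the
    block-diagonal part of Lam and J2 its off-diagonal part:
    I f = f diag(K, K) and J2 f = f [0 S; S 0], with K a complex structure and S
    a reflection that anticommute (lemmas matI_Lam, matJ_Lam, adapted_frame_I,
    adapted_frame_J).  The relations I^2 = -1, J2^2 = 1, I J2 = - J2 I and the
    behaviour of h are then identities between block matrices.

    The remaining algebra is formal.  I anticommutes with J1 and J2, hence
    exchanges their eigenspaces for 1 and -1, which therefore have equal
    dimensions (anticomm_eigen_dim); anticommutators also show that I, J1, J2
    are linearly independent, because the fibres are not zero (pq_free).
    Smoothness follows from that of N and Nx, since smooth functions form an
    algebra.

    For parallelism, the block form of the elements of H means that they commute
    with the matrices of I and J2 (H_form_comm), and so do the elements of the
    Lie algebra (lie_algebra_comm).  When the connection form w of f commutes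
    with the constant matrix L of A, one gets (D_v A) f_j = 0
    (cov_frame_comm).  Each of I, J1, J2 multiplies h by a constant c = 1 or -1;
    differentiating h(A s, A f_j) = h(s, c f_j) by metric compatibility extends
    the conclusion from the f_j to an arbitrary section s
    (parallel_of_frame). *)

(** * Frames and matrices *)

Section FrameAlgebra.
Variables (R : realType) (V : vectType R) (k : nat).
Implicit Types (e f : 'I_k -> V) (A B : 'M[R]_k) (X Y : 'End(V)).

Lemma fmulM e A B : fmul (fmul e A) B = fmul e (A *m B).
Proof.
apply/funext => j; rewrite /fmul.
under eq_bigr do rewrite scaler_sumr.
rewrite exchange_big; apply: eq_bigr => i _.
rewrite mxE scaler_suml; apply: eq_bigr => l _.
by rewrite scalerA mulrC.
Qed.

Lemma fmul1 e : fmul e 1%:M = e.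
Proof.
apply/funext => j; rewrite /fmul (bigD1 j)//= mxE eqxx scale1r big1 ?addr0//.
by move=> i ij; rewrite mxE (negbTE ij) scale0r.
Qed.

Lemma fmulD e A B j : fmul e (A + B) j = fmul e A j + fmul e B j.
Proof. by rewrite -big_split; apply: eq_bigr => i _; rewrite mxE scalerDl. Qed.

Lemma fmulZ e a A j : fmul e (a *: A) j = a *: fmul e A j.
Proof.
by rewrite scaler_sumr; apply: eq_bigr => i _; rewrite mxE scalerA.
Qed.

Lemma lfun_fmul X f A :
  (fun j => X (fmul f A j)) = fmul (fun j => X (f j)) A.
Proof.
apply/funext => j; rewrite /fmul linear_sum.
by apply: eq_bigr => i _; rewrite linearZ.
Qed.

Lemma fmul_diag e (d : 'rV[R]_k) j : fmul e (diag_mx d) j = d 0 j *: e j.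
Proof.
rewrite /fmul (bigD1 j)//= mxE eqxx mulr1n big1 ?addr0//.
by move=> i ij; rewrite mxE (negbTE ij) mulr0n scale0r.
Qed.

Lemma is_basis_span e : is_basis e ->
  forall u, exists c : 'I_k -> R, u = \sum_i c i *: e i.
Proof.
move=> eb u; exists (fun i => coord [tuple e i | i < k] i u).
rewrite {1}(coord_basis eb (memvf u)); apply: eq_bigr => i _.
by rewrite -tnth_nth tnth_mktuple.
Qed.

Lemma is_basis_dim e : is_basis e -> \dim {:V} = k.
Proof. exact: size_basis. Qed.

(** Every vector is a linear combination of the family f. *)
Definition spans f := forall u, exists c : 'I_k -> R, u = \sum_i c i *: f i.

Lemma spans_fmul e A B : spans e -> A *m B = 1%:M -> spans (fmul e A).
Proof.
move=> se AB u; have [c ->] := se u.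
exists (fun i => \sum_j c j * B i j).
under [RHS]eq_bigr do rewrite scaler_suml.
rewrite exchange_big; apply: eq_bigr => j _.
have -> : e j = fmul (fmul e A) B j by rewrite fmulM AB fmul1.
by rewrite {1}/fmul scaler_sumr; apply: eq_bigr => i _; rewrite scalerA.
Qed.

Lemma spans_lfun_eq f X Y : spans f -> (forall j, X (f j) = Y (f j)) -> X = Y.
Proof.
move=> sf XY; apply/lfunP => u; have [c ->] := sf u.
by rewrite !linear_sum; apply: eq_bigr => i _; rewrite !linearZ/= XY.
Qed.

(** [acts f X A]: A is the matrix of X in the frame f, that is X f = f A. *)
Definition acts f X A := (fun j => X (f j)) = fmul f A.

Lemma actsP f X A j : acts f X A -> X (f j) = fmul f A j.
Proof. by move/(congr1 (fun F => F j)). Qed.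

Lemma acts_comp f X Y A B :
  acts f X A -> acts f Y B -> acts f (X \o Y)%VF (A *m B).
Proof.
move=> XA YB; apply/funext => j.
rewrite comp_lfunE (actsP j YB) -fmulM -[in RHS]XA.
by rewrite (congr1 (fun F => F j) (lfun_fmul X f B)).
Qed.

Lemma acts_add f X Y A B : acts f X A -> acts f Y B -> acts f (X + Y) (A + B).
Proof.
by move=> XA YB; apply/funext => j; rewrite add_lfunE (actsP j XA) (actsP j YB) fmulD.
Qed.

Lemma acts_scale f X a A : acts f X A -> acts f (a *: X) (a *: A).
Proof. by move=> XA; apply/funext => j; rewrite scale_lfunE (actsP j XA) fmulZ. Qed.

Lemma acts_opp f X A : acts f X A -> acts f (- X) (- A).
Proof. by rewrite -[- X]scaleN1r -[- A]scaleN1r; exact: acts_scale. Qed.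

Lemma acts_id f : acts f \1%VF 1%:M.
Proof. by rewrite /acts fmul1; apply/funext => j; rewrite lfunE. Qed.

Lemma acts_inj f X Y A : spans f -> acts f X A -> acts f Y A -> X = Y.
Proof.
by move=> sf XA YA; apply: (spans_lfun_eq sf) => j; rewrite (actsP j XA) (actsP j YA).
Qed.

(** If X f = f A and B' inverts B, then X (f B) = (f B)(B' A B). *)
Lemma acts_fmul f X A B B' :
  B *m B' = 1%:M -> acts f X A -> acts (fmul f B) X (B' *m A *m B).
Proof.
move=> BB' XA; rewrite /acts lfun_fmul XA !fmulM.
by rewrite !mulmxA BB' mul1mx.
Qed.

End FrameAlgebra.

(** * Symmetric bilinear forms in a frame *)

Section Bilinear.
Variables (R : realType) (V : vectType R) (b : V -> V -> R).
Hypothesis b_sym : forall u v, b u v = b v u.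
Hypothesis b_linear : forall a u v w, b (a *: u + v) w = a * b u w + b v w.

Lemma bilin0l w : b 0 w = 0.
Proof.
by have := b_linear 1 0 0 w; rewrite scaler0 addr0 mul1r => /eqP;
   rewrite -subr_eq subrr eq_sym => /eqP.
Qed.

Lemma bilin_suml (I : finType) (c : I -> R) (u : I -> V) w :
  b (\sum_i c i *: u i) w = \sum_i c i * b (u i) w.
Proof.
apply: (big_rec2 (fun x y => b x w = y)); first exact: bilin0l.
by move=> i y x _ <-; rewrite b_linear.
Qed.

Lemma bilin_sum (I J : finType) (c : I -> R) (d : J -> R) u v :
  b (\sum_i c i *: u i) (\sum_j d j *: v j) =
  \sum_i \sum_j c i * d j * b (u i) (v j).
Proof.
rewrite bilin_suml; apply: eq_bigr => i _.
rewrite b_sym bilin_suml mulr_sumr; apply: eq_bigr => j _.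
by rewrite b_sym mulrA.
Qed.

Variables (k : nat).
Implicit Types (f : 'I_k -> V) (G A : 'M[R]_k).

Lemma gram_fmul f G A : (forall i j, b (f i) (f j) = G i j) ->
  forall i j, b (fmul f A i) (fmul f A j) = (A^T *m G *m A) i j.
Proof.
move=> fG i j; rewrite bilin_sum mxE exchange_big.
apply: eq_bigr => l _; rewrite mxE mulr_suml; apply: eq_bigr => p _.
by rewrite mxE fG; ring.
Qed.

Lemma bilin_comp f G A c (X : 'End(V)) : spans f ->
  (forall i j, b (f i) (f j) = G i j) ->
  acts f X A -> A^T *m G *m A = c *: G ->
  forall u v, b (X u) (X v) = c * b u v.
Proof.
move=> sf fG XA AG u v; have [cu ->] := sf u; have [cv ->] := sf v.
rewrite !linear_sum/=.
under eq_bigr do rewrite linearZ/=.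
under [in X in b _ X]eq_bigr do rewrite linearZ/=.
rewrite !bilin_sum mulr_sumr; apply: eq_bigr => i _.
rewrite mulr_sumr; apply: eq_bigr => j _.
rewrite (actsP i XA) (actsP j XA) (gram_fmul A fG) AG mxE fG; ring.
Qed.

End Bilinear.

Lemma half_double (R : realType) (U : lmodType R) (u : U) : 2^-1 *: (u + u) = u.
Proof. by rewrite -[u in LHS]scale1r -scalerDl scalerA mulVf ?scale1r ?pnatr_eq0. Qed.

(** * The matrices of the nilpotent structures *)

Section BlockMatrices.
Variables (R : realType) (n : nat) (eps : bool).
Local Notation M2 := 'M[R]_(n + n).
Local Notation M4 := 'M[R]_(n + n + (n + n)).
Local Notation I4 := (I4eps R n eps).

(** Kblock is a complex structure of R^n + R^n and Sblock a reflection; they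
    anticommute. *)
Definition Kblock : M2 := block_mx 0 (- 1%:M) 1%:M 0.
Definition Sblock : M2 := block_mx 0 1%:M 1%:M 0.

(** The matrices of I and J2 in a frame e I' with e admissible. *)
Definition matI : M4 := block_mx Kblock 0 0 Kblock.
Definition matJ : M4 := block_mx 0 Sblock Sblock 0.

Lemma KblockK : Kblock *m Kblock = - 1%:M.
Proof.
rewrite mulmx_block !mulmx0 !mul0mx !mulmx1 !mul1mx !addr0 !add0r.
by rewrite scalar_mx_block opp_block_mx !oppr0.
Qed.

Lemma SblockK : Sblock *m Sblock = 1%:M.
Proof.
rewrite mulmx_block !mulmx0 !mul0mx !mulmx1 !addr0 !add0r.
by rewrite -scalar_mx_block.
Qed.

Lemma KSblock : Kblock *m Sblock = - (Sblock *m Kblock).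
Proof.
rewrite !mulmx_block !mulmx0 !mul0mx !mulmx1 !mul1mx !addr0 !add0r.
by rewrite opp_block_mx !oppr0 opprK.
Qed.

Lemma Kblock_tr : Kblock^T = - Kblock.
Proof. by rewrite tr_block_mx opp_block_mx !trmx0 linearN/= trmx1 opprK oppr0. Qed.

Lemma Sblock_tr : Sblock^T = Sblock.
Proof. by rewrite tr_block_mx !trmx0 trmx1. Qed.

Lemma LamE : Lam R n = block_mx Kblock Sblock Sblock Kblock.
Proof. by []. Qed.

Lemma eta_conj (A B C D : M2) :
  eta R n *m block_mx A B C D *m eta R n = block_mx A (- B) (- C) D.
Proof.
rewrite /eta !mulmx_block !mulmx0 !mul0mx !mulmx1 !mul1mx !addr0 !add0r.
by rewrite !mulNmx !mulmxN !mulmx1 !mul1mx opprK.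
Qed.

Lemma etaK : eta R n *m eta R n = 1%:M.
Proof.
have := eta_conj 1%:M 0 0 1%:M.
by rewrite !oppr0 -scalar_mx_block mulmx1.
Qed.

Lemma matI_Lam : matI = 2^-1 *: (Lam R n + eta R n *m Lam R n *m eta R n).
Proof.
rewrite LamE eta_conj add_block_mx scale_block_mx !subrr !scaler0.
by rewrite !half_double.
Qed.

Lemma matJ_Lam : matJ = 2^-1 *: (Lam R n - eta R n *m Lam R n *m eta R n).
Proof.
rewrite LamE eta_conj opp_block_mx add_block_mx scale_block_mx !opprK !subrr.
by rewrite !scaler0 !half_double.
Qed.

Lemma matIK : matI *m matI = - 1%:M.
Proof.
rewrite mulmx_block !mulmx0 !mul0mx !addr0 !add0r KblockK.
by rewrite [in RHS]scalar_mx_block opp_block_mx !oppr0.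
Qed.

Lemma matJK : matJ *m matJ = 1%:M.
Proof.
rewrite mulmx_block !mulmx0 !mul0mx !addr0 !add0r SblockK.
by rewrite -scalar_mx_block.
Qed.

Lemma matIJ : matI *m matJ = - (matJ *m matI).
Proof.
rewrite /matI /matJ; move: Kblock Sblock KSblock => K S KS.
rewrite !mulmx_block !mulmx0 !mul0mx !addr0 !add0r KS.
by rewrite opp_block_mx !oppr0.
Qed.

Lemma matI_eta : matI^T *m eta R n *m matI = eta R n.
Proof.
rewrite /matI tr_block_mx !trmx0 Kblock_tr; move: Kblock KblockK => K KK.
rewrite !mulmx_block !mulmx0 !mul0mx !addr0 !add0r.
by rewrite mulmxN !mulmx1 !mulNmx !mul0mx KK !opprK.
Qed.

Lemma matJ_eta : matJ^T *m eta R n *m matJ = - eta R n.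
Proof.
rewrite /matJ tr_block_mx !trmx0 Sblock_tr; move: Sblock SblockK => S SK.
rewrite !mulmx_block !mulmx0 !mul0mx !addr0 !add0r.
by rewrite mulmxN !mulmx1 !mulNmx !mul0mx SK opp_block_mx opprK !oppr0.
Qed.

Lemma I4epsK : I4 *m I4 = 1%:M.
Proof.
have IK : Ieps R n eps *m Ieps R n eps = 1%:M.
  rewrite /Ieps mulmx_diag -diag_const_mx; congr diag_mx.
  apply/rowP => j; rewrite !mxE; case: ifP => _; last by rewrite mulr1.
  by rewrite -expr2 sqrr_sign.
rewrite /I4eps !mulmx_block !mulmx0 !mul0mx !mulmx1 !addr0 !add0r IK.
by rewrite -!scalar_mx_block.
Qed.

Lemma I4eps_eta : I4 *m eta R n = eta R n *m I4.
Proof.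
rewrite !mulmx_block !mulmx0 !mul0mx !mulmx1 !addr0 !add0r.
by rewrite mulNmx mulmxN mul1mx mulmx1.
Qed.

Lemma I4eps_tr : I4^T = I4.
Proof. by rewrite /I4eps !tr_block_mx !trmx0 !trmx1 tr_diag_mx. Qed.

Lemma I4eps_gram : I4^T *m eta R n *m I4 = eta R n.
Proof. by rewrite I4eps_tr I4eps_eta -mulmxA I4epsK mulmx1. Qed.

(** The block form that defines H is the commutant of matI and matJ; only
    this inclusion is used. *)
Lemma H_form_comm A : H_form A ->
  A *m matI = matI *m A /\ A *m matJ = matJ *m A.
Proof.
move=> [A11 [A21 [A31 [A41 ->]]]].
rewrite /matI /matJ /Kblock /Sblock !mulmx_block.
rewrite !(mulmx0, mul0mx) -!block_mx0 !add_block_mx.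
by rewrite !(addr0, add0r, mulNmx, mulmxN, mulmx1, mul1mx, opprK).
Qed.

End BlockMatrices.

Lemma flip_timeE (R : realType) (m n : nat) (M : manifold R m)
    (E : vbundle M (n + n + (n + n))) x (e : 'I_(n + n + (n + n)) -> E x) :
  flip_time e = fmul e (eta R n).
Proof.
have -> : eta R n = diag_mx (row_mx (const_mx 1) (const_mx (-1))).
  by rewrite diag_mx_row !diag_const_mx /eta raddfN.
apply/funext => j; rewrite fmul_diag /flip_time mxE.
by case: split_ordP => i ->/=; rewrite mxE ?scale1r ?scaleN1r.
Qed.

(** * Paraquaternionic endomorphisms of a vector space *)

Section Paraquaternions.
Variables (R : realType) (V : vectType R) (I J2 : 'End(V)).
Hypothesis II : (I \o I)%VF = - \1%VF.
Hypothesis JJ : (J2 \o J2)%VF = \1%VF.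
Hypothesis IJ : (I \o J2)%VF = - (J2 \o I)%VF.
Let J1 : 'End(V) := - (I \o J2)%VF.

Lemma pq_IIv u : I (I u) = - u.
Proof. by rewrite -comp_lfunE II opp_lfunE lfunE. Qed.

Lemma pq_JJv u : J2 (J2 u) = u.
Proof. by rewrite -comp_lfunE JJ lfunE. Qed.

Lemma pq_IJv u : I (J2 u) = - J2 (I u).
Proof. by rewrite -comp_lfunE IJ opp_lfunE comp_lfunE. Qed.

Lemma pq_J1v u : J1 u = J2 (I u).
Proof. by rewrite opp_lfunE comp_lfunE pq_IJv opprK. Qed.

Lemma pq_IJ1 : (I \o J1)%VF = J2.
Proof.
by apply/lfunP => u; rewrite comp_lfunE pq_J1v pq_IJv pq_IIv linearN opprK.
Qed.

Lemma pq_J1K : (J1 \o J1)%VF = \1%VF.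
Proof.
by apply/lfunP => u; rewrite comp_lfunE !pq_J1v pq_IJv linearN/= pq_JJv pq_IIv opprK lfunE.
Qed.

Lemma pq_IJ1_anti : (I \o J1)%VF = - (J1 \o I)%VF.
Proof.
rewrite pq_IJ1; apply/lfunP => u.
by rewrite opp_lfunE comp_lfunE pq_J1v pq_IIv linearN opprK.
Qed.

(** I maps the eigenspace of J for a into the one for -a, injectively. *)
Lemma anticomm_eigen_le (J : 'End(V)) a : (I \o J)%VF = - (J \o I)%VF ->
  (\dim (passmx.leigenspace J a) <= \dim (passmx.leigenspace J (- a)))%N.
Proof.
move=> IJa; have kerI : (lker I == 0)%VS.
  apply/lker0P => u v /(congr1 I); rewrite !pq_IIv; exact: oppr_inj.
rewrite -(limg_dim_eq (f := I)); last by rewrite (eqP kerI) capv0.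
apply: dimvS; apply/subvP => w /memv_imgP [u + ->].
rewrite !memv_ker !add_lfunE !opp_lfunE !scale_lfunE !lfunE/= subr_eq0 => /eqP Ju.
have := congr1 (fun F : 'End(V) => F u) IJa.
rewrite opp_lfunE !comp_lfunE Ju linearZ/= => /(congr1 (fun w => - w)).
by rewrite opprK => <-; rewrite scaleNr opprK addNr.
Qed.

Lemma anticomm_eigen_dim (J : 'End(V)) : (I \o J)%VF = - (J \o I)%VF ->
  \dim (passmx.leigenspace J 1) = \dim (passmx.leigenspace J (-1)).
Proof.
move=> IJa; apply/eqP; rewrite eqn_leq anticomm_eigen_le//=.
by have := anticomm_eigen_le (-1) IJa; rewrite opprK.
Qed.

(** In a linear relation, the anticommutators with I and J2 isolate the
    coefficients of I and J2; that of J1 is then zero as well. *)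
Lemma pq_free : (0 < \dim {:V})%N -> free [tuple I; J1; J2].
Proof.
move=> V0; have [u u0] : exists u : V, u != 0.
  exists (vpick {:V}%VS); rewrite vpick0 -dimv_eq0 -lt0n; exact: V0.
apply/freeP => c; rewrite !big_ord_recl big_ord0/= addr0 /bump/=.
set a := c ord0; set b := c (lift _ _); set d := c (lift _ _) => c0.
have cv w : a *: I w + (b *: J2 (I w) + d *: J2 w) = 0.
  have /(congr1 (fun F : 'End(V) => F w)) := c0.
  by rewrite !add_lfunE !scale_lfunE pq_J1v lfunE.
have dbl0 (r : R) : r *: u + r *: u = 0 -> r = 0.
  by rewrite -scalerDl => /eqP; rewrite scaler_eq0 (negbTE u0) orbF => /eqP r0; lra.
have a0 : a = 0.
  apply: dbl0; apply: oppr_inj; rewrite oppr0 opprD.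
  have := congr1 I (cv u); rewrite linear0 !linearD !linearZ/= !pq_IJv.
  rewrite !pq_IIv (linearN J2) opprK => h1.
  have := cv (I u); rewrite pq_IIv (linearN J2) => h2.
  have := congr2 +%R h1 h2; rewrite addr0 addrACA !scalerN.
  by rewrite [X in _ + X]addrACA addrN addNr addr0 addr0.
have bd w : b *: I w + d *: w = 0.
  have := congr1 J2 (cv w); rewrite a0 scale0r add0r linear0.
  by rewrite linearD !linearZ/= !pq_JJv.
have d0 : d = 0.
  apply: dbl0; have := congr1 J2 (bd (J2 u)); rewrite linear0.
  rewrite linearD !linearZ/= pq_IJv (linearN J2)/= !pq_JJv scalerN => h.
  by have := congr2 +%R h (bd u); rewrite addr0 addrACA addNr add0r.
have b0 : b = 0.
  move: (bd (I u)); rewrite d0 scale0r addr0 pq_IIv => /eqP.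
  by rewrite scaler_eq0 oppr_eq0 (negbTE u0) orbF => /eqP.
move=> i; case: i => -[|[|[|//]]] Hi.
- by rewrite -[RHS]a0; congr c; apply: val_inj.
- by rewrite -[RHS]b0; congr c; apply: val_inj.
- by rewrite -[RHS]d0; congr c; apply: val_inj.
Qed.
End Paraquaternions.

(** * Smooth functions, sections and endomorphism fields *)

Lemma open_near (T : topologicalType) (O : set T) (x : T) (P : T -> Prop) :
  open O -> O x -> (forall y, O y -> P y) -> \near x, P x.
Proof. by move=> oO Ox OP; apply: filterS OP _; exact: open_nbhs_nbhs. Qed.

Lemma continuous_near_eq (T U : topologicalType) (f g : T -> U) (x : T) :
  (\near x, f x = g x) -> {for x, continuous f} -> {for x, continuous g}.
Proof.
move=> fg cf; change (g @ x --> g x); rewrite -(nbhs_singleton fg).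
exact: cvg_trans (near_eq_cvg fg) cf.
Qed.

Section CkFunctions.
Variables (R : realType) (m : nat).
Implicit Types (O : set 'rV[R]_m) (f g : 'rV[R]_m -> R).

Lemma Ck_ext k O f g : open O -> (forall x, O x -> f x = g x) ->
  Ck k O f -> Ck k O g.
Proof.
move=> oO; elim: k f g => [|k IH] f g fg [cf df].
  by split => // x Ox; apply: continuous_near_eq (cf x Ox); exact: open_near Ox fg.
have fgx x : O x -> \near x, f x = g x by move=> Ox; exact: open_near Ox fg.
split; first by move=> x Ox; apply: continuous_near_eq (cf x Ox); exact: fgx.
move=> i; have [dfi Cfi] := df i; split.
  by move=> x Ox; apply: near_eq_derivable (dfi x Ox); exact: fgx.
by apply: IH Cfi => x Ox; apply: near_eq_derive; exact: fgx.
Qed.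

Lemma Ck_sub k O O' f : O' `<=` O -> Ck k O f -> Ck k O' f.
Proof.
move=> sO; elim: k f => [|k IH] f [cf df]; split.
- by move=> x /sO; exact: cf.
- by [].
- by move=> x /sO; exact: cf.
move=> i; have [dfi Cfi] := df i; split; last exact: IH.
by move=> x /sO; exact: dfi.
Qed.

Lemma Ck_pred k O f : Ck k.+1 O f -> Ck k O f.
Proof.
elim: k f => [|k IH] f; first by case.
move=> [cf df]; split => // i; have [dfi Cfi] := df i; split => //.
exact: IH.
Qed.

Lemma Ck_cst k O (a : R) : open O -> Ck k O (fun=> a).
Proof.
move=> oO; elim: k a => [|k IH] a; split => //; try by move=> x _; exact: cst_continuous.
move=> i; split; first by move=> x _; exact: derivable_cst.
by apply: Ck_ext (IH 0) => // x _; rewrite derive_cst.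
Qed.

Lemma Ck_add k O f g : open O -> Ck k O f -> Ck k O g ->
  Ck k O (fun x => f x + g x).
Proof.
move=> oO; elim: k f g => [|k IH] f g [cf df] [cg dg]; split => //.
- by move=> x Ox; apply: continuousD; [exact: cf|exact: cg].
- by move=> x Ox; apply: continuousD; [exact: cf|exact: cg].
move=> i; have [dfi Cfi] := df i; have [dgi Cgi] := dg i; split.
  by move=> x Ox; apply: derivableD; [exact: dfi|exact: dgi].
apply: Ck_ext (IH _ _ Cfi Cgi) => // x Ox.
by rewrite -deriveD//; [exact: dfi|exact: dgi].
Qed.

Lemma Ck_mul k O f g : open O -> Ck k O f -> Ck k O g ->
  Ck k O (fun x => f x * g x).
Proof.
move=> oO; elim: k f g => [|k IH] f g Cf Cg.
  case: Cf Cg => [cf _] [cg _]; split => // x Ox.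
  by apply: continuousM; [exact: cf|exact: cg].
have Cf' := Ck_pred Cf; have Cg' := Ck_pred Cg.
case: Cf Cg => [cf df] [cg dg]; split => //.
  by move=> x Ox; apply: continuousM; [exact: cf|exact: cg].
move=> i; have [dfi Cfi] := df i; have [dgi Cgi] := dg i; split.
  by move=> x Ox; apply: derivableM; [exact: dfi|exact: dgi].
apply: Ck_ext (Ck_add oO (IH _ _ Cf' Cgi) (IH _ _ Cg' Cfi)) => // x Ox.
by rewrite -[LHS]deriveM//; [exact: dfi|exact: dgi].
Qed.

End CkFunctions.

Section SmoothOn.
Variables (R : realType) (m : nat) (M : manifold R m).
Implicit Types (U W : set M) (f g : M -> R).

(** Charts are open maps, because their inverses are continuous. *)
Lemma ch_image_open (i : ch_idx M) U :
  open U -> open (ch_map i @` (ch_dom i `&` U)).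
Proof.
move=> oU; rewrite openE => _ [x [dx Ux] <-].
have mx : (ch_map i @` ch_dom i) (ch_map i x) by exists x.
have n1 : nbhs (ch_map i x) (ch_map i @` ch_dom i).
  by apply: open_nbhs_nbhs; split => //; exact: ch_open_image.
have n2 : nbhs (ch_map i x) (ch_inv i @^-1` U).
  apply: (ch_inv_continuous mx); rewrite ch_mapK//.
  exact: open_nbhs_nbhs.
apply: filterS2 n1 n2 => _ [y dy <-]; rewrite /= ch_mapK// => Uy.
by exists y.
Qed.

Lemma smooth_on_ext U f g : open U -> (forall x, U x -> f x = g x) ->
  smooth_on U f -> smooth_on U g.
Proof.
move=> oU fg sf i k; apply: Ck_ext (sf i k); first exact: ch_image_open.
by move=> _ [x [dx Ux] <-]; rewrite ch_mapK// fg.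
Qed.

Lemma smooth_on_sub U W f : W `<=` U -> smooth_on U f -> smooth_on W f.
Proof.
move=> WU sf i k; apply: Ck_sub (sf i k) => _ [x [dx Wx] <-].
by exists x => //; split => //; exact: WU.
Qed.

Lemma smooth_on_cst U (a : R) : open U -> smooth_on U (fun=> a).
Proof. by move=> oU i k; apply: Ck_cst; exact: ch_image_open. Qed.

Lemma smooth_onD U f g : open U -> smooth_on U f -> smooth_on U g ->
  smooth_on U (fun x => f x + g x).
Proof.
by move=> oU sf sg i k; apply: Ck_add; [exact: ch_image_open|exact: sf|exact: sg].
Qed.

Lemma smooth_onM U f g : open U -> smooth_on U f -> smooth_on U g ->
  smooth_on U (fun x => f x * g x).
Proof.
by move=> oU sf sg i k; apply: Ck_mul; [exact: ch_image_open|exact: sf|exact: sg].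
Qed.

Lemma smooth_on_sum U (I : finType) (f : I -> M -> R) : open U ->
  (forall i, smooth_on U (f i)) -> smooth_on U (fun x => \sum_i f i x).
Proof.
move=> oU sf; elim: (index_enum I) => [|i r IH].
  by apply: smooth_on_ext (smooth_on_cst 0 oU) => // x _; rewrite big_nil.
by apply: smooth_on_ext (smooth_onD oU (sf i) IH) => // x _; rewrite big_cons.
Qed.

End SmoothOn.

Section SmoothSections.
Variables (R : realType) (m : nat) (M : manifold R m) (k : nat).
Variable E : vbundle M k.
Implicit Types (U W : set M) (s t : sect E) (A B : end_sect E).

Let openIdom (i : vb_idx E) U : open U -> open (U `&` vb_dom i).
Proof. by move=> oU; apply: openI => //; exact: vb_open. Qed.

Lemma smooth_sectD U s t : open U -> smooth_sect U s -> smooth_sect U t ->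
  smooth_sect U (fun x => s x + t x).
Proof.
move=> oU ss st i; have [c [sc cE]] := ss i; have [d [sd dE]] := st i.
exists (fun x a => c x a + d x a); split.
  by move=> a; apply: smooth_onD; first exact: openIdom.
move=> x Ux; rewrite cE// dE// -big_split; apply: eq_bigr => a _.
by rewrite scalerDl.
Qed.

Lemma smooth_sectZ U (a : R) s : open U -> smooth_sect U s ->
  smooth_sect U (fun x => a *: s x).
Proof.
move=> oU ss i; have [c [sc cE]] := ss i.
exists (fun x b => a * c x b); split.
  move=> b; apply: smooth_onM => //; first exact: openIdom.
  by apply: smooth_on_cst; exact: openIdom.
by move=> x Ux; rewrite cE// scaler_sumr; apply: eq_bigr => b _; rewrite scalerA.
Qed.

Lemma smooth_sect0 U : open U -> smooth_sect U (fun x => 0 : E x).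
Proof.
move=> oU i; exists (fun _ _ => 0); split.
  by move=> a; apply: smooth_on_cst; exact: openIdom.
by move=> x _; rewrite big1// => a _; rewrite scale0r.
Qed.

Lemma smooth_sect_sum U (I : finType) (r : seq I) (a : I -> R)
    (s : I -> sect E) : open U -> (forall i, smooth_sect U (s i)) ->
  smooth_sect U (fun x => \sum_(i <- r) a i *: s i x).
Proof.
move=> oU ss; elim: r => [|i r IH].
  have -> : (fun x : M => \sum_(i <- [::]) a i *: s i x) = (fun x => 0 : E x).
    by apply/functional_extensionality_dep => x; rewrite big_nil.
  exact: smooth_sect0.
have -> : (fun x : M => \sum_(j <- i :: r) a j *: s j x) =
    (fun x => a i *: s i x + \sum_(j <- r) a j *: s j x).
  by apply/functional_extensionality_dep => x; rewrite big_cons.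
by apply: smooth_sectD => //; exact: smooth_sectZ.
Qed.

Lemma smooth_sect_fmul U (e : frame_field E) (A : 'M[R]_k) j : open U ->
  (forall i, smooth_sect U (fun x => e x i)) ->
  smooth_sect U (fun x => fmul (e x) A j).
Proof. by move=> oU se; apply: smooth_sect_sum. Qed.

Lemma smooth_end_apply U A s : open U -> smooth_end_sect setT A ->
  smooth_sect U s -> smooth_sect U (fun x => A x (s x)).
Proof.
move=> oU sA ss i; have [c [sc cE]] := ss i; have [d [sd dE]] := sA i.
exists (fun x b => \sum_a d x b a * c x a); split.
  move=> b; apply: smooth_on_sum; first exact: openIdom.
  move=> a; apply: smooth_onM => //; first exact: openIdom.
  by apply: smooth_on_sub (sd b a); exact: setSI.
move=> x [Ux ix]; rewrite cE// linear_sum.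
under eq_bigr => a _ do rewrite linearZ/= (congr1 (fun F => F a) (dE x (conj I ix))).
under [RHS]eq_bigr do rewrite scaler_suml.
rewrite exchange_big; apply: eq_bigr => a _; rewrite scaler_sumr.
by apply: eq_bigr => b _; rewrite scalerA mulrC.
Qed.

Lemma smooth_endD U A B : open U ->
  smooth_end_sect U A -> smooth_end_sect U B ->
  smooth_end_sect U (fun x => A x + B x).
Proof.
move=> oU sA sB i; have [c [sc cE]] := sA i; have [d [sd dE]] := sB i.
exists (fun x => c x + d x); split.
  move=> a b; have oUi := openIdom i oU.
  by apply: smooth_on_ext (smooth_onD oUi (sc a b) (sd a b)) => // x _; rewrite mxE.
by move=> x Ux; exact: acts_add (cE x Ux) (dE x Ux).
Qed.

Lemma smooth_endZ U (r : R) A : open U -> smooth_end_sect U A ->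
  smooth_end_sect U (fun x => r *: A x).
Proof.
move=> oU sA i; have [c [sc cE]] := sA i.
exists (fun x => r *: c x); split.
  move=> a b; have oUi := openIdom i oU.
  apply: smooth_on_ext (smooth_onM oUi (smooth_on_cst r oUi) (sc a b)) => // x _.
  by rewrite mxE.
by move=> x Ux; exact: acts_scale (cE x Ux).
Qed.

Lemma smooth_endN U A : open U -> smooth_end_sect U A ->
  smooth_end_sect U (fun x => - A x).
Proof.
move=> oU /(smooth_endZ (-1) oU); congr smooth_end_sect.
by apply/functional_extensionality_dep => x; rewrite scaleN1r.
Qed.

Lemma smooth_end_comp U A B : open U ->
  smooth_end_sect U A -> smooth_end_sect U B ->
  smooth_end_sect U (fun x => (A x \o B x)%VF).
Proof.
move=> oU sA sB i; have [c [sc cE]] := sA i; have [d [sd dE]] := sB i.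
exists (fun x => c x *m d x); split.
  move=> a b; have oUi := openIdom i oU.
  have sM l : smooth_on (U `&` vb_dom i) (fun x => c x a l * d x l b).
    exact: smooth_onM.
  by apply: smooth_on_ext (smooth_on_sum oUi sM) => // x _; rewrite mxE.
by move=> x Ux; exact: acts_comp (cE x Ux) (dE x Ux).
Qed.

End SmoothSections.

(** * Parallel endomorphism fields *)

(** A linear relation satisfied on G passes to the velocities of curves in G. *)
Lemma lie_algebra_comm (R : realType) (k : nat) (G : set 'M[R]_k) (L X : 'M[R]_k) :
  (forall A, G A -> A *m L = L *m A) -> lie_algebra G X -> X *m L = L *m X.
Proof.
move=> GL [c [sc cG c0 cX]]; apply/matrixP => i j.
have dc p q : is_derive (0 : R) 1 (fun t => c t p q) (X p q).
  by rewrite -cX derive1E; apply: derivableP; exact: (sc p q 0%N 0).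
have lin (a : 'I_k -> R) (p q : 'I_k -> 'I_k) :
    is_derive (0 : R) 1 (fun t => \sum_l a l * c t (p l) (q l))
      (\sum_l a l * X (p l) (q l)).
  have := is_derive_sum (fun l => is_deriveZ (a l) (dc (p l) (q l))).
  by rewrite fct_sumE.
have := lin (L^~ j) (fun=> i) id; have := lin (L i) id (fun=> j).
have -> : (fun t => \sum_l L i l * c t l j) = (fun t => \sum_l L l j * c t i l).
  apply/funext => t; have := congr1 (fun A : 'M[R]_k => A i j) (GL _ (cG t)).
  by rewrite !mxE => <-; apply: eq_bigr => l _; rewrite mulrC.
move=> /@derive_val d1 /@derive_val; rewrite d1 !mxE => ->.
by apply: eq_bigr => l _; rewrite mulrC.
Qed.

Section Tangent.
Variables (R : realType) (m : nat) (M : manifold R m) (x : M).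
Variable v : (M -> R) -> R.
Hypothesis vx : is_tangent x v.

Lemma smooth_near_cst (a : R) : smooth_near x (fun=> a).
Proof. by exists setT; split=> //; [exact: openT|apply: smooth_on_cst; exact: openT]. Qed.

Lemma tangent_cst (a : R) : v (fun=> a) = 0.
Proof.
have [_ vD vM _] := vx.
have v0 : v (fun=> 0) = 0.
  have := vM _ _ (smooth_near_cst 0) (smooth_near_cst 0).
  by rewrite !mulr0 mul0r add0r.
have v1 : v (fun=> 1) = 0.
  have := vM _ _ (smooth_near_cst 1) (smooth_near_cst 1).
  by rewrite !mulr1 mul1r => /eqP; rewrite -subr_eq subrr eq_sym => /eqP.
have := vD a _ _ (smooth_near_cst 1) (smooth_near_cst 0).
by rewrite mulr1 addr0 v1 v0 mulr0 addr0.
Qed.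

End Tangent.

Section Connections.
Variables (R : realType) (m : nat) (M : manifold R m) (k : nat).
Variables (E : vbundle M k) (D : connection E).
Implicit Types (U : set M) (s : sect E) (f : frame_field E).

Lemma smooth_sect_nearI U x s :
  open U -> U x -> smooth_sect U s -> smooth_sect_near x s.
Proof. by exists U. Qed.

Lemma cov_scale x v (a : R) s : is_tangent x v -> smooth_sect_near x s ->
  D x v (fun y => a *: s y) = a *: D x v s.
Proof.
move=> vx ss; rewrite (cov_leibniz D vx (smooth_near_cst x a) ss).
by rewrite (tangent_cst vx) scale0r add0r.
Qed.

Lemma cov_lincomb U x v (I : finType) (a : I -> R) (s : I -> sect E) :
  open U -> U x -> is_tangent x v -> (forall i, smooth_sect U (s i)) ->
  D x v (fun y => \sum_i a i *: s i y) = \sum_i a i *: D x v (s i).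
Proof.
move=> oU Ux vx ss.
have near (t : sect E) : smooth_sect U t -> smooth_sect_near x t.
  exact: smooth_sect_nearI.
elim: (index_enum I) => [|i r IH].
  have -> : (fun y : M => \sum_(i <- [::]) a i *: s i y) =
      (fun y => 0 *: (0 : E y)).
    by apply/functional_extensionality_dep => y; rewrite big_nil scale0r.
  by rewrite (cov_scale _ vx (near _ (smooth_sect0 (E:=E) oU))) scale0r big_nil.
have -> : (fun y : M => \sum_(j <- i :: r) a j *: s j y) =
    (fun y => a i *: s i y + \sum_(j <- r) a j *: s j y).
  by apply/functional_extensionality_dep => y; rewrite big_cons.
rewrite big_cons -IH -(cov_scale _ vx (near _ (ss i))).
apply: cov_add => //; apply: near; last exact: smooth_sect_sum.
exact: smooth_sectZ.
Qed.

(** If A f = f L with L constant, D f = f w and w L = L w, then D A annihilates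
    the frame f. *)
Lemma cov_frame_comm U x v f (A : end_sect E) (L w : 'M[R]_k) j :
  open U -> U x -> is_tangent x v ->
  (forall i, smooth_sect U (fun y => f y i)) -> smooth_end_sect setT A ->
  (forall y, U y -> acts (f y) (A y) L) ->
  (fun i => D x v (fun y => f y i)) = fmul (f x) w -> w *m L = L *m w ->
  D x v (fun y => A y (f y j)) = A x (D x v (fun y => f y j)).
Proof.
move=> oU Ux vx sf sA AL Df wL.
have sAf : smooth_sect_near x (fun y => A y (f y j)).
  by apply: (smooth_sect_nearI oU Ux); apply: smooth_end_apply.
rewrite (@cov_local _ _ _ _ _ D _ _ _ (fun y => fmul (f y) L j) vx sAf); last first.
  by apply: (open_near oU Ux) => y Uy; exact: (actsP j (AL y Uy)).
rewrite /fmul (cov_lincomb _ oU Ux vx sf).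
have -> : \sum_i L i j *: D x v (fun y => f y i) =
    fmul (fun i => D x v (fun y => f y i)) L j by [].
have -> : D x v (fun y => f y j) = fmul (f x) w j by rewrite -Df.
rewrite Df fmulM wL -fmulM -(AL x Ux).
by rewrite (congr1 (fun F => F j) (lfun_fmul (A x) (f x) w)).
Qed.

End Connections.

Section MetricParallel.
Variables (R : realType) (m n : nat) (M : manifold R m).
Variables (E : vbundle M (n + n + (n + n))) (h : neutral_metric E).
Variable D : connection E.
Hypothesis hD : metric_connection h D.

Lemma metric_nondegenerate x (w : E x) : (forall u, h x w u = 0) -> w = 0.
Proof.
move=> w0; have [e [eb eh]] := metric_signature h x.
have [c wE] := is_basis_span eb w; pose C := \row_i c i.
have C0 : C *m eta R n = 0.
  apply/rowP => j; rewrite !mxE -[RHS](w0 (e j)) wE.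
  rewrite (bilin_suml (@metric_linear _ _ _ _ _ h x)).
  by apply: eq_bigr => i _; rewrite mxE eh.
have {}C0 : C = 0 by rewrite -[C]mulmx1 -(etaK R n) mulmxA C0 mul0mx.
rewrite wE big1// => i _; have := congr1 (fun A : 'rV_ _ => A 0 i) C0.
by rewrite !mxE => ->; rewrite scale0r.
Qed.

(** It suffices to test parallelism on a frame when A is a homothety of h:
    differentiating h(A s, A f_j) = c h(s, f_j) along v gives
    h((D_v A) s, A f_j) = 0 for every j.  No expansion of s in the frame f is
    needed. *)
Lemma parallel_of_frame (A : end_sect E) (c : R) :
  smooth_end_sect setT A ->
  (forall x u v, h x (A x u) (A x v) = c * h x u v) ->
  (forall x u, exists w, A x w = u) ->
  (forall x, exists U (f : frame_field E), [/\ open U, U x,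
     forall j, smooth_sect U (fun y => f y j), spans (f x) &
     forall v j, is_tangent x v ->
       D x v (fun y => A y (f y j)) = A x (D x v (fun y => f y j))]) ->
  parallel D A.
Proof.
move=> sA Ah Asurj Af x v s vx [W [oW Wx ss]].
have [U [f [oU Ux sf spf Df]]] := Af x.
have hsym := @Defs.metric_sym _ _ _ _ _ h x; have hlin := @metric_linear _ _ _ _ _ h x.
have hrZ a u w : h x u (a *: w) = a * h x u w.
  by rewrite hsym -[a *: w]addr0 hlin hsym (bilin0l hlin) addr0.
have ns := smooth_sect_nearI oW Wx ss.
have nAs := smooth_sect_nearI oW Wx (smooth_end_apply oW sA ss).
(* Both sides of h(A s, A f_j) = h(s, c f_j) are differentiated along v; the
   terms with D f_j cancel. *)
have key j : h x (D x v (fun y => A y (s y)) - A x (D x v s)) (A x (f x j)) = 0.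
  have nf := smooth_sect_nearI oU Ux (sf j).
  have nAf := smooth_sect_nearI oU Ux (smooth_end_apply oU sA (sf j)).
  have ncf := smooth_sect_nearI oU Ux (smooth_sectZ c oU (sf j)).
  have := hD vx nAs nAf; have := hD vx ns ncf.
  have -> : (fun y => h y (s y) (c *: f y j)) =
      (fun y => h y (A y (s y)) (A y (f y j))).
    apply/funext => y; rewrite Ah Defs.metric_sym -[c *: _]addr0 metric_linear.
    by rewrite (bilin0l (@metric_linear _ _ _ _ _ h y)) addr0 Defs.metric_sym.
  move=> -> ; rewrite (cov_scale _ _ vx nf) !hrZ -!Ah -(Df v j vx) => /addIr e.
  by rewrite addrC -scaleN1r hlin e mulN1r addNr.
apply: metric_nondegenerate => u; have [u' <-] := Asurj x u.
have [a ->] := spf u'; rewrite linear_sum hsym.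
under eq_bigr do rewrite linearZ/=.
by rewrite (bilin_suml hlin) big1// => j _; rewrite hsym key mulr0.
Qed.

End MetricParallel.

(** * The structure defined by a nilpotent structure and its dual *)

Section NilpotentPair.
Variables (R : realType) (m n : nat) (M : manifold R m).
Variables (E : vbundle M (n + n + (n + n))) (o : orientation E).
Variables (h : neutral_metric E) (eps : bool).
Variables (N Nx : end_sect E) (P Px : frame_family E).
Hypothesis HN : H_nilpotent o h eps N P.
Hypothesis HNx : H_dual o h eps N P Nx Px.

Local Notation I4 := (I4eps R n eps).
Local Notation L := (Lam R n).
Local Notation eta := (eta R n).

Let I : end_sect E := fun x => 2^-1 *: (N x + Nx x).
Let J2 : end_sect E := fun x => 2^-1 *: (N x - Nx x).
Let J1 : end_sect E := fun x => - (I x \o J2 x)%VF.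

(** The frame e I' of E, for the local section e of P indexed by l. *)
Definition adapted_frame (l : ff_idx P) : frame_field E :=
  fun x => fmul (ff_frame l x) I4.

Lemma adapted_frame_N l x : ff_dom l x -> acts (adapted_frame l x) (N x) L.
Proof. by case: HN => _ _ _ /(_ l) [_ _ _ NL] _ lx; exact: NL. Qed.

(** The flipped frame e eta is admissible for the dual structure, and eta
    commutes with I'. *)
Lemma adapted_frame_Nx l x : ff_dom l x ->
  acts (adapted_frame l x) (Nx x) (eta *m L *m eta).
Proof.
case: HN => _ lo _ la lH lx; case: HNx => _ dual.
have : H_admissible o h eps Nx Px (ff_dom l) (fun y => flip_time (ff_frame l y)).
  apply/(dual _ _ (lo l)); exists (ff_frame l) => //.
  by split=> // l' y [ly l'y]; exact: lH.
move=> [[_ _ _ /(_ x lx)] + _]; rewrite flip_timeE fmulM -I4eps_eta -fmulM.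
rewrite -[fmul (fmul _ _) eta]/(fmul (adapted_frame l x) eta) => NxL.
have := acts_fmul (etaK R n) NxL.
by rewrite fmulM etaK fmul1.
Qed.

Lemma adapted_frame_spans l x : ff_dom l x -> spans (adapted_frame l x).
Proof.
case: HN => _ _ _ /(_ l) [[eb _] _ _ _] _ lx.
exact: spans_fmul (is_basis_span (eb x lx)) (I4epsK R n eps).
Qed.

Lemma adapted_frame_gram l x : ff_dom l x ->
  forall i j, h x (adapted_frame l x i) (adapted_frame l x j) = eta i j.
Proof.
case: HN => _ _ _ /(_ l) [_ eh _ _] _ lx i j.
rewrite (gram_fmul (@Defs.metric_sym _ _ _ _ _ h x)
  (@metric_linear _ _ _ _ _ h x) I4 (eh x lx)).
by rewrite I4eps_gram.
Qed.

Lemma adapted_frame_smooth l j :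
  smooth_sect (ff_dom l) (fun x => adapted_frame l x j).
Proof.
case: HN => _ lo _ /(_ l) [[_ es] _ _ _] _.
exact: smooth_sect_fmul.
Qed.

Lemma adapted_frame_I l x : ff_dom l x ->
  acts (adapted_frame l x) (I x) (matI R n).
Proof.
move=> lx; rewrite matI_Lam; apply: acts_scale; apply: acts_add.
  exact: adapted_frame_N.
exact: adapted_frame_Nx.
Qed.

Lemma adapted_frame_J l x : ff_dom l x ->
  acts (adapted_frame l x) (J2 x) (matJ R n).
Proof.
move=> lx; rewrite matJ_Lam; apply: acts_scale; apply: acts_add.
  exact: adapted_frame_N.
by apply: acts_opp; exact: adapted_frame_Nx.
Qed.

Let cover x : exists l : ff_idx P, ff_dom l x.
Proof. by case: HN. Qed.

Lemma dual_II x : (I x \o I x)%VF = - \1%VF.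
Proof.
have [l lx] := cover x; have a := adapted_frame_I lx.
apply: acts_inj (adapted_frame_spans lx) (acts_comp a a) _.
by rewrite matIK; apply: acts_opp; exact: acts_id.
Qed.

Lemma dual_JJ x : (J2 x \o J2 x)%VF = \1%VF.
Proof.
have [l lx] := cover x; have a := adapted_frame_J lx.
apply: acts_inj (adapted_frame_spans lx) (acts_comp a a) _.
by rewrite matJK; exact: acts_id.
Qed.

Lemma dual_IJ x : (I x \o J2 x)%VF = - (J2 x \o I x)%VF.
Proof.
have [l lx] := cover x.
have a := adapted_frame_I lx; have b := adapted_frame_J lx.
apply: acts_inj (adapted_frame_spans lx) (acts_comp a b) _.
by rewrite matIJ; apply: acts_opp; exact: acts_comp.
Qed.

Lemma dual_hI x u v : h x (I x u) (I x v) = h x u v.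
Proof.
have [l lx] := cover x; rewrite -[RHS]mul1r.
apply: (bilin_comp (@Defs.metric_sym _ _ _ _ _ h x)
  (@metric_linear _ _ _ _ _ h x) (adapted_frame_spans lx)
  (adapted_frame_gram lx) (adapted_frame_I lx)).
by rewrite matI_eta scale1r.
Qed.

Lemma dual_hJ2 x u v : h x (J2 x u) (J2 x v) = - h x u v.
Proof.
have [l lx] := cover x; rewrite -mulN1r.
apply: (bilin_comp (@Defs.metric_sym _ _ _ _ _ h x)
  (@metric_linear _ _ _ _ _ h x) (adapted_frame_spans lx)
  (adapted_frame_gram lx) (adapted_frame_J lx)).
by rewrite matJ_eta scaleN1r.
Qed.

Lemma dual_hJ1 x u v : h x (J1 x u) (J1 x v) = - h x u v.
Proof.
by rewrite /J1 !(pq_J1v (dual_IJ x)) dual_hJ2 dual_hI.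
Qed.

Let sN : smooth_end_sect setT N. Proof. by case: HN => -[]. Qed.
Let sNx : smooth_end_sect setT Nx. Proof. by case: HNx => -[[]]. Qed.

Lemma dual_smoothI : smooth_end_sect setT I.
Proof. by apply: smooth_endZ; [exact: openT|apply: smooth_endD => //; exact: openT]. Qed.

Lemma dual_smoothJ2 : smooth_end_sect setT J2.
Proof.
apply: smooth_endZ; first exact: openT.
by apply: smooth_endD; [exact: openT| |apply: smooth_endN => //; exact: openT].
Qed.

Lemma dual_smoothJ1 : smooth_end_sect setT J1.
Proof.
apply: smooth_endN; first exact: openT.
by apply: smooth_end_comp; [exact: openT|exact: dual_smoothI|exact: dual_smoothJ2].
Qed.

Lemma dual_complex : complex_structure I.
Proof. by split; [exact: dual_smoothI|exact: dual_II]. Qed.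

Lemma dual_paracomplex1 : paracomplex_structure J1.
Proof.
split=> [|x|x]; first exact: dual_smoothJ1.
  exact: pq_J1K (dual_II x) (dual_JJ x) (dual_IJ x).
apply: (anticomm_eigen_dim (dual_II x)).
exact: pq_IJ1_anti (dual_II x) (dual_IJ x).
Qed.

Lemma dual_paracomplex2 : paracomplex_structure J2.
Proof.
split=> [|x|x]; [exact: dual_smoothJ2|exact: dual_JJ|].
exact: (anticomm_eigen_dim (dual_II x) (dual_IJ x)).
Qed.

Lemma dual_paraquaternionic : (0 < n)%N -> paraquaternionic I J1 J2.
Proof.
move=> n0; split=> [x|x]; first exact: pq_IJ1 (dual_II x) (dual_IJ x).
exists setT, (fun i y => tnth [tuple I y; J1 y; J2 y] i); split=> //.
- exact: openT.
- case=> -[|[|[|//]]] Hi; [exact: dual_smoothI|exact: dual_smoothJ1|exact: dual_smoothJ2].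
move=> y _.
have -> : [tuple tnth [tuple I y; J1 y; J2 y] i | i < 3] = [tuple I y; J1 y; J2 y].
  by apply: eq_from_tnth => i; rewrite tnth_mktuple.
rewrite /basis_of eqxx/=; apply: pq_free; [exact: dual_II|exact: dual_JJ|exact: dual_IJ|].
have [l ly] := cover y; case: HN => _ _ _ /(_ l) [[eb _] _ _ _] _.
by rewrite (is_basis_dim (eb y ly)) !addn_gt0 n0.
Qed.

Lemma dual_adapted : adapted h I J1 J2.
Proof. by split; [exact: dual_hI|exact: dual_hJ1|exact: dual_hJ2]. Qed.

Variable D : connection E.
Hypothesis hD : metric_connection h D.
Hypothesis HD : H_nilpotent_conn o h eps D N P.

(** An endomorphism field whose matrix in the frames e I' is constant and
    commutes with H is parallel along these frames. *)
Lemma adapted_frame_parallel (A : end_sect E) (B : 'M[R]_(n + n + (n + n))) :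
  smooth_end_sect setT A ->
  (forall l x, ff_dom l x -> acts (adapted_frame l x) (A x) B) ->
  (forall C, H_form C -> C *m B = B *m C) ->
  forall x, exists U (f : frame_field E), [/\ open U, U x,
    forall j, smooth_sect U (fun y => f y j), spans (f x) &
    forall v j, is_tangent x v ->
      D x v (fun y => A y (f y j)) = A x (D x v (fun y => f y j))].
Proof.
move=> sA AB HB x; have [l lx] := cover x.
have lo : open (ff_dom l) by case: HN.
exists (ff_dom l), (adapted_frame l); split=> //.
- by move=> j; exact: adapted_frame_smooth.
- exact: adapted_frame_spans.
move=> v j vx; case: HD => _ /(_ l) [w /(_ x v lx vx) Dw /(_ x v lx vx) wH].
apply: (cov_frame_comm (f := adapted_frame l) (L := B) j lo lx vx _ sA _ Dw) => //.
- by move=> i; exact: adapted_frame_smooth.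
- by move=> y; exact: AB.
by apply: lie_algebra_comm wH => C [_]; exact: HB.
Qed.

Lemma dual_parallelI : parallel D I.
Proof.
apply: (parallel_of_frame (c := 1) hD dual_smoothI).
- by move=> x u v; rewrite mul1r dual_hI.
- by move=> x u; exists (- I x u); rewrite linearN/= (pq_IIv (dual_II x)) opprK.
apply: (adapted_frame_parallel dual_smoothI); first by move=> l x; exact: adapted_frame_I.
by move=> C /H_form_comm[].
Qed.

Lemma dual_parallelJ2 : parallel D J2.
Proof.
apply: (parallel_of_frame (c := -1) hD dual_smoothJ2).
- by move=> x u v; rewrite mulN1r dual_hJ2.
- by move=> x u; exists (J2 x u); rewrite (pq_JJv (dual_JJ x)).
apply: (adapted_frame_parallel dual_smoothJ2); first by move=> l x; exact: adapted_frame_J.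
by move=> C /H_form_comm[].
Qed.

Lemma dual_parallelJ1 : parallel D J1.
Proof.
apply: (parallel_of_frame (c := -1) hD dual_smoothJ1).
- by move=> x u v; rewrite mulN1r dual_hJ1.
- move=> x u; exists (J1 x u); rewrite -comp_lfunE.
  by rewrite (pq_J1K (dual_II x) (dual_JJ x) (dual_IJ x)) lfunE.
apply: (adapted_frame_parallel (B := - (matI R n *m matJ R n)) dual_smoothJ1).
  move=> l x lx; apply: acts_opp; apply: acts_comp.
    exact: adapted_frame_I.
  exact: adapted_frame_J.
move=> C /H_form_comm[CI CJ].
by rewrite mulmxN mulNmx mulmxA CI -mulmxA CJ mulmxA.
Qed.

End NilpotentPair.

Theorem corollary4p6 (R : realType) (m n : nat) (n_gt0 : (0 < n)%N)
  (M : manifold R m) (E : vbundle M (n + n + (n + n))) (o : orientation E)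
  (h : neutral_metric E) (D : connection E) (hD : metric_connection h D)
  (eps : bool) (N : end_sect E) (P : frame_family E)
  (HN : H_nilpotent o h eps N P)
  (Nx : end_sect E) (Px : frame_family E)
  (HNx : H_dual o h eps N P Nx Px) :
  let I : end_sect E := fun x => 2^-1 *: (N x + Nx x) in
  let J2 : end_sect E := fun x => 2^-1 *: (N x - Nx x) in
  let J1 : end_sect E := fun x => - (I x \o J2 x)%VF in
  [/\ complex_structure I,
      paracomplex_structure J1,
      paracomplex_structure J2,
      paraquaternionic I J1 J2
    & adapted h I J1 J2] /\
  (H_nilpotent_conn o h eps D N P -> neutral_hyperkahler h D I J1 J2).
Proof.
have cI := dual_complex HN HNx.
have pJ1 := dual_paracomplex1 HN HNx; have pJ2 := dual_paracomplex2 HN HNx.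
have pq := dual_paraquaternionic HN HNx n_gt0; have ad := dual_adapted HN HNx.
split=> // HD; split=> //; split=> //.
- exact (dual_parallelI HN HNx hD HD).
- exact (dual_parallelJ1 HN HNx hD HD).
- exact (dual_parallelJ2 HN HNx hD HD).
Qed.
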